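(* Let $N$ be a random variable concentrated on $\{0,1,2,\dots,K\}$ ($K$ may be infinite) with distribution $\mu_k=P(N=k)>0$ for $0\le k\le K$ satisfying Panjer's recursion: for some $a,b\in\mathbb{R}$, $$\frac{(k+1)\mu_{k+1}}{\mu_k}=a+bk,\qquad k=0,1,\dots,K,$$ with $\mu_{K+1}=0$ (when $K<\infty$). Let $S_N=\sum_{j=1}^NX_j$ (with $S_0=0$), where the $X_j$ are iid random variables, independent of $N$, concentrated on $\mathbb{Z}_+$ with probabilities $P(X_1=k)=p_k$. If $\mathbb{E}(S_N)<\infty$, then a Stein operator for $S_N$ is given, for $g\in\mathcal{G}_{S_N}$, by $$(\mathcal{A}g)(j)=\sum_{l=1}^\infty(al+bj)\,g(l+j)\,p_l-(1-bp_0)\,j\,g(j),\quad j\in\mathbb{Z}_+,$$ i.e. $\mathbb{E}(\mathcal{A}g)(S_N)=0$ for every $g\in\mathcal{G}_{S_N}$.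
   Context: $\mathbb{Z}_+=\{0,1,2,\dots\}$. For a $\mathbb{Z}_+$-valued random variable $Y$ with finite mean, $\mathcal{G}_Y$ is the set of bounded functions $g:\mathbb{Z}_+\to\mathbb{R}$ with $g(0)=0$ and $g(x)=0$ for $x\notin \mathrm{supp}(Y)$. A Stein operator for $Y$ is a linear operator $\mathcal{A}$ such that $\mathbb{E}(\mathcal{A}g)(Y)=0$ for all $g\in\mathcal{G}_Y$. *)

(* Defs.v *)
From HB Require Import structures.
From mathcomp Require Import all_boot all_order all_algebra finmap.
From mathcomp Require Import all_classical all_reals all_analysis.

Set Implicit Arguments.
Unset Strict Implicit.
Unset Printing Implicit Defensive.

Import Order.TTheory GRing.Theory Num.Theory.
Import numFieldNormedType.Exports.

Local Open Scope classical_set_scope.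
Local Open Scope ring_scope.

Section independence.
Context d (T : measurableType d) (R : realType) (P : probability T R).

Definition mutually_independent (I : choiceType) (F : I -> set_system T) :=
  forall (J : {fset I}) (E : I -> set T), (forall i, i \in J -> F i (E i)) ->
    P (\bigcap_(i in [set` J]) E i) = (\prod_(i <- J) P (E i))%E.

Definition independent (F G : set_system T) :=
  forall A B, F A -> G B -> P (A `&` B) = (P A * P B)%E.

(* The sigma-algebra generated by a sequence of random variables. *)
Definition sigma_seq (X : nat -> {RV P >-> nat}) : set_system T :=
  <<s \bigcup_j g_sigma_algebra_preimage (X j) >>.

(* Mathcomp's [pmf] only covers real-valued random variables. *)
Definition nat_pmf (Y : {RV P >-> nat}) (k : nat) : R :=
  fine (distribution P Y [set k]).

Definition iid (X : nat -> {RV P >-> nat}) :=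
  mutually_independent (fun j => g_sigma_algebra_preimage (X j)) /\
  forall j, distribution P (X j) =1 distribution P (X 0%N).

End independence.

Section random_sum.
Context d (T : measurableType d).

(* The summands are indexed from 0: [X j] is the (j+1)-st summand. *)
Definition random_sum (N : T -> nat) (X : nat -> T -> nat) (w : T) : nat :=
  (\sum_(j < N w) X j w)%N.

Variables (N : {mfun T >-> nat}) (X : nat -> {mfun T >-> nat}).

Let measurable_sum n k : measurable [set w | (\sum_(j < n) X j w)%N = k].
Proof.
elim: n k => [|n IH] k.
  have [->|k0] := eqVneq k 0%N.
    by under eq_set do rewrite big_ord0; rewrite (_ : [set _ | _] = setT) //;
      apply/seteqP; split.
  rewrite (_ : [set _ | _] = set0) //.
  by apply/seteqP; split => // w /=; rewrite big_ord0 => /esym/eqP; exact/negP.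
rewrite (_ : [set _ | _] = \bigcup_i
    ([set w | (\sum_(j < n) X j w)%N = i] `&`
     (X n @^-1` [set m | (i + m)%N = k]))).
  apply: bigcup_measurable => i _; apply: measurableI; first exact: IH.
  exact: measurable_funPTI.
apply/seteqP; split => w /=.
  by rewrite big_ord_recr /= => wk; exists (\sum_(j < n) X j w)%N.
by move=> [i _ [/= <-]]; rewrite big_ord_recr.
Qed.

Let measurable_random_sum : measurable_fun [set: T] (random_sum N X).
Proof.
move=> _ B _; rewrite setTI.
rewrite (_ : _ @^-1` _ = \bigcup_n \bigcup_(k in B) (N @^-1` [set n] `&`
    [set w | (\sum_(j < n) X j w)%N = k])).
  apply: bigcup_measurable => n _; apply: bigcup_measurable => k _.
  by apply: measurableI => //; exact: measurable_funPTI.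
apply/seteqP; split => w /=.
  by move=> BS; exists (N w) => //; exists (random_sum N X w).
by move=> [n _ [k Bk [/= Nn wk]]]; rewrite /random_sum Nn wk.
Qed.

HB.instance Definition _ :=
  isMeasurableFun.Build _ _ T nat (random_sum N X) measurable_random_sum.

End random_sum.

Section stein.
Context d (T : measurableType d) (R : realType) (P : probability T R).

Definition supp (Y : {RV P >-> nat}) : set nat := [set k | 0 < nat_pmf Y k].

Definition stein_class (Y : {RV P >-> nat}) : set (nat -> R) :=
  [set g | [/\ bounded_fun (g : nat -> R^o), g 0%N = 0 &
             forall x, ~ supp Y x -> g x = 0]].

(* The expectation is extended-real valued, and [oo - oo] is not 0 there, so
   the second clause includes integrability of [A g] at [Y]. *)
Definition stein_operator (Y : {RV P >-> nat})
    (A : (nat -> R) -> nat -> R) :=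
  (forall c g h, stein_class Y g -> stein_class Y h -> forall j,
     A (fun k => c * g k + h k) j = c * A g j + A h j) /\
  forall g, stein_class Y g -> ('E_P[fun w => A g (Y w)] = 0)%E.

End stein.

(* [None] stands for an infinite upper bound. *)
Definition below (K : option nat) (k : nat) : bool :=
  if K is Some m then (k <= m)%N else true.

Definition panjer_series_term (R : realType) (a b : R) (p g : nat -> R)
    (j l : nat) : R :=
  (a * l%:R + b * j%:R) * g (l + j)%N * p l.

Definition panjer_operator (R : realType) (a b : R) (p g : nat -> R)
    (j : nat) : R :=
  (\big[+%R/0]_(1 <= l <oo) panjer_series_term a b p g j l)
  - (1 - b * p 0%N) * j%:R * g j.

(* Main.v *)
(* Let f be the mass function of S_N and q_n that of X_1 + ... + X_n.  By the
   size-bias identity m q_(n+1)(m) = (n+1) sum_l l p_l q_n(m-l), Panjer's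
   recursion for N lifts to
     sum_(l <= m) (a l + b (m - l)) p_l f(m - l) = m f(m),
   which says that E (A g)(S_N) = 0 when g is concentrated at m, hence when g
   has finite support.  A general g is truncated to [0, M[; since
   E S_N >= mu_1 E X_1, the truncated A g are dominated by an affine function
   of S_N unless K = 0, in which case S_N = 0 and g = 0.  Dominated
   convergence concludes. *)
Require Import Defs.
From mathcomp Require Import all_boot all_order all_algebra finmap.
From mathcomp Require Import all_classical all_reals all_analysis.
From mathcomp Require Import measurable_realfun ring.
Set Implicit Arguments.
Unset Strict Implicit.
Import Order.TTheory GRing.Theory Num.Theory.
Import numFieldNormedType.Exports.
Local Open Scope classical_set_scope.
Local Open Scope ring_scope.

(** * Convolution powers and the size-bias identity *)

Section convolution_power.
Context {R : comNzRingType}.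
Implicit Types (p : nat -> R) (n m k : nat).

(** For a mass function [p], this is the law [q_n] of a sum of [n] independent copies. *)
Fixpoint conv_pow p n k : R :=
  if n is n'.+1 then \sum_(i < k.+1) p i * conv_pow p n' (k - i)
  else (k == 0)%:R.

(** Coefficients up to degree [k] of a power involve only the [p i] with [i <= k], so an infinite
    sequence can be cut to a polynomial, where derivatives are available. *)
Lemma conv_pow_poly p n k M : (k <= M)%N ->
  conv_pow p n k = ((\poly_(i < M.+1) p i) ^+ n)`_k.
Proof.
elim: n k => [|n IH] k kM /=; first by rewrite expr0 coef1.
rewrite exprS coefM; apply: eq_bigr => -[i /= ik] _.
by rewrite coef_poly ltnS (leq_trans _ kM) // IH // (leq_trans (leq_subr _ _)).
Qed.

(* Compare coefficients in [X (P^n.+1)' = n.+1 (X P') P^n], where [P] is the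
   generating polynomial of [p] truncated at degree [m]. *)
Lemma conv_pow_size_bias p n m :
  m%:R * conv_pow p n.+1 m =
  n.+1%:R * \sum_(l < m.+1) l%:R * p l * conv_pow p n (m - l).
Proof.
pose P := \poly_(i < m.+1) p i.
have coefXderiv (q : {poly R}) l : ('X * q^`())`_l = l%:R * q`_l.
  by rewrite coefXM; case: l => [|l]; rewrite ?mul0r //= coef_deriv mulr_natl.
rewrite (conv_pow_poly _ _ (leqnn m)) -coefXderiv deriv_exp /=.
rewrite mulrnAr mulrA -/P coefMn -[LHS]mulr_natl.
rewrite coefM; congr (_ * _); apply: eq_bigr => -[i /= im] _.
by rewrite coefXderiv coef_poly im (conv_pow_poly _ _ (leq_subr i m)).
Qed.

(** Write the weight [m] of the size-bias identity as [l + (m - l)] and cancel the part with [l].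
    This turns the factor [b * n] of Panjer's recursion into the weight [b * (m - l)]. *)
Lemma conv_pow_weight_swap p n m :
  \sum_(l < m.+1) (m - l)%:R * p l * conv_pow p n (m - l) =
  n%:R * \sum_(l < m.+1) l%:R * p l * conv_pow p n (m - l).
Proof.
have := conv_pow_size_bias p n m.
rewrite -natr1 mulrDl mul1r => /eqP.
rewrite -subr_eq => /eqP <-; rewrite [conv_pow p n.+1 m]/= mulr_sumr -sumrB.
apply: eq_bigr => -[i /= im] _; rewrite natrB //; ring.
Qed.

End convolution_power.

(** * Lifting Panjer's recursion to the mixture *)

Section panjer_recursion.
Context {R : realType}.
Variables (mu p f : nat -> R) (a b : R).
Hypothesis panjer : forall n, n.+1%:R * mu n.+1 = (a + b * n%:R) * mu n.
Hypothesis f_mixture : forall k,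
  (fun M => \sum_(n < M) mu n * conv_pow p n k) @ \oo --> f k.

Lemma panjer_recursion m :
  \sum_(l < m.+1) (a * l%:R + b * (m - l)%:R) * p l * f (m - l) = m%:R * f m.
Proof.
pose u M := \sum_(n < M) mu n * (m%:R * conv_pow p n m).
(* The term [n = 0] vanishes, since [m * conv_pow p 0 m = 0] for every [m]. Size bias and Panjer's
   recursion rewrite the term [n.+1] through [mu n], so [M.+1] terms on the left match [M] on the
   right. *)
have uE M : u M.+1 = \sum_(l < m.+1) (a * l%:R + b * (m - l)%:R) * p l *
                       \sum_(n < M) mu n * conv_pow p n (m - l).
  transitivity (\sum_(n < M) mu n * \sum_(l < m.+1)
      (a * l%:R + b * (m - l)%:R) * p l * conv_pow p n (m - l)).
    rewrite /u big_ord_recl /= (_ : m%:R * _ = 0) ?mulr0 ?add0r; last first.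
      by case: m {u} => [|m]; rewrite ?mul0r //= mulr0.
    apply: eq_bigr => n _; rewrite conv_pow_size_bias mulrCA mulrA panjer.
    rewrite mulrAC mulrC; congr (_ * _); rewrite mulrDl mulr_sumr.
    rewrite -mulrA -conv_pow_weight_swap mulr_sumr.
    by rewrite -big_split; apply: eq_bigr => l _ /=; ring.
  under eq_bigr do rewrite mulr_sumr.
  rewrite exchange_big; apply: eq_bigr => l _; rewrite mulr_sumr.
  by apply: eq_bigr => n _; ring.
have uf : u @ \oo --> m%:R * f m.
  rewrite (_ : u = fun M => m%:R * \sum_(n < M) mu n * conv_pow p n m).
    by apply: cvgMl_tmp; exact: f_mixture.
  by apply/funext => M; rewrite mulr_sumr; apply: eq_bigr => n _; ring.
move: uf; rewrite -cvg_shiftS => uf.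
apply: (cvg_unique _ _ uf) => //=.
under eq_fun do rewrite uE.
apply: cvg_big; first exact: add_continuous.
by move=> l _; apply: cvgMl_tmp; exact: f_mixture.
Qed.

End panjer_recursion.

(** * Law of the partial sums *)

Section partial_sums.
Context d (T : measurableType d) (R : realType) (P : probability T R).
Variable X : nat -> {RV P >-> nat}.
Let p := nat_pmf (X 0%N).
Let B n k := [set w | (\sum_(j < n) X j w)%N = k].

Let B0 k : B 0 k = if k == 0%N then setT else set0.
Proof.
apply/seteqP; rewrite /B; split=> w /=; rewrite big_ord0; case: eqVneq => //.
by move=> k0 /esym/eqP; rewrite (negbTE k0).
Qed.

Let BS n k : B n.+1 k =
  \big[setU/set0]_(i < k.+1) (B n (k - i) `&` X n @^-1` [set val i]).
Proof.
rewrite -(bigcup_mkord _ (fun i => B n (k - i) `&` X n @^-1` [set i])).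
apply/seteqP; rewrite /B; split=> w /=.
  rewrite big_ord_recr /= => wk; exists (X n w); rewrite /= -?wk.
    by rewrite ltnS leq_addl.
  by rewrite addnK.
by move=> [i /=]; rewrite ltnS big_ord_recr /= => ik [-> ->]; rewrite subnK.
Qed.

(** Independence from [N] is stated for the sigma-algebra [sigma_seq X], so these events must be
    placed in it. The induction splits on the value of the last summand. *)
Lemma sigma_seq_partial_sum n k :
  sigma_seq X [set w | (\sum_(j < n) X j w)%N = k].
Proof.
rewrite -/(B n k) /sigma_seq; set G := (X in <<s X>>).
suff mB n' k' : @measurable _ (g_sigma_algebraType G) (B n' k') by exact: mB.
elim: n' k' => [|m IH] l; first by rewrite B0; case: ifP.
rewrite BS; apply: (@bigsetU_measurable _ (g_sigma_algebraType G)) => i _.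
apply: measurableI; first exact: IH.
apply: (@sub_sigma_algebra _ setT); exists m => //; exists [set val i] => //.
by rewrite setTI.
Qed.

Lemma measurable_partial_sum n k :
  measurable [set w | (\sum_(j < n) X j w)%N = k].
Proof.
have := sigma_seq_partial_sum n k; apply: smallest_sub.
  exact: sigma_algebra_measurable.
move=> A [j _ [C mC <-]]; rewrite setTI; exact: measurable_funPTI.
Qed.

Hypothesis X_iid : iid X.

(* The induction on [n] moves the event [X n = i] into the family [E]. *)
Lemma partial_sum_indep n k (J : {fset nat}) (E : nat -> set T) :
    (forall j, j \in J -> (n <= j)%N) ->
    (forall j, j \in J -> g_sigma_algebra_preimage (X j) (E j)) ->
  P ([set w | (\sum_(j < n) X j w)%N = k] `&` \bigcap_(j in [set` J]) E j) =
  ((conv_pow p n k)%:E * \prod_(j <- J) P (E j))%E.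
Proof.
elim: n k J E => [|n IH] k J E nJ JE.
  rewrite -/(B 0 k) B0 /=; case: eqVneq => _; last first.
    by rewrite set0I measure0 mul0e.
  by rewrite setTI mul1e; exact: X_iid.1.
have mE j : j \in J -> measurable (E j).
  by move=> /JE [C mC <-]; rewrite setTI; exact: measurable_funPTI.
set C := \bigcap_(j in _) _.
have mC : measurable C.
  by apply: bigcap_measurableType => j /= jJ; exact: mE.
have nnotJ : n \notin J by apply/negP => /nJ; rewrite ltnn.
have PC : (\prod_(j <- J) P (E j) = (fine (P C))%:E)%E.
  by rewrite -X_iid.1 // fineK // fin_num_measure.
have term i : P (B n (k - i) `&` X n @^-1` [set i] `&` C) =
    (p i * conv_pow p n (k - i) * fine (P C))%:E.
  (* Since all indices in [J] exceed [n], setting the entry at [n] leaves the events over [J]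
     unchanged. *)
  pose E' j := if j == n then X n @^-1` [set i] else E j.
  have E'J j : j \in J -> E' j = E j.
    by rewrite /E'; case: eqVneq => // -> /(negP nnotJ).
  have -> : B n (k - i) `&` X n @^-1` [set i] `&` C =
      B n (k - i) `&` \bigcap_(j in [set` (n |` J)%fset]) E' j.
    rewrite -setIA bigcap_fsetU1 {1}/E' eqxx; congr (_ `&` (_ `&` _)).
    by apply: eq_bigcapr => j /= jJ; rewrite E'J.
  rewrite /B IH; last 2 first.
  - by move=> j; rewrite in_fset1U => /orP[/eqP->//|/nJ /ltnW].
  - move=> j; rewrite in_fset1U => /orP[/eqP->|jJ].
      by rewrite /E' eqxx; exists [set i] => //; rewrite setTI.
    by rewrite E'J //; exact: JE.
  rewrite big_fsetU1 //= (eq_big_seq (fun j => P (E j))); last first.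
    by move=> j jJ /=; rewrite E'J.
  rewrite PC {1}/E' eqxx (_ : P _ = (p i)%:E) ?EFinM.
    by rewrite muleCA muleA.
  have := X_iid.2 n [set i]; rewrite /distribution /pushforward => ->.
  by rewrite fineK // fin_num_measure.
pose F i := B n (k - i) `&` X n @^-1` [set i] `&` C.
have -> : [set w | (\sum_(j < n.+1) X j w)%N = k] `&` C =
    \big[setU/set0]_(i < k.+1) F i.
  rewrite -/(B n.+1 k) BS -(bigcup_mkord _
    (fun i => B n (k - i) `&` X n @^-1` [set i])).
  by rewrite setI_bigcupl bigcup_mkord.
rewrite measure_bigsetU //; last 2 first.
- move=> i; apply: measurableI => //; apply: measurableI.
    exact: measurable_partial_sum.
  exact: measurable_funPTI.
- by move=> i j _ _ [w [[[_ /= <-] _] [[_ /= <-] _]]].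
by rewrite PC -EFinM mulr_suml -sumEFin; apply: eq_bigr => i _; rewrite -term.
Qed.

Lemma partial_sum_pmf n k :
  P [set w | (\sum_(j < n) X j w)%N = k] = (conv_pow p n k)%:E.
Proof.
have := @partial_sum_indep n k fset0 (fun=> setT).
by rewrite set_fset0 bigcap_set0 setIT big_seq_fset0 mule1 => ->.
Qed.

End partial_sums.

(** * Mass function of the random sum *)

Section random_sum_pmf.
Context d (T : measurableType d) (R : realType) (P : probability T R).
Variables (N : {RV P >-> nat}) (X : nat -> {RV P >-> nat}).
Hypothesis X_iid : iid X.
Hypothesis NX : independent P (g_sigma_algebra_preimage N) (sigma_seq X).
Let mu := nat_pmf N.
Let p := nat_pmf (X 0%N).
Let S : {RV P >-> nat} := random_sum N X.
Let F k n := N @^-1` [set n] `&` [set w | (\sum_(j < n) X j w)%N = k].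

Lemma nat_pmfE (Y : {RV P >-> nat}) k :
  P (Y @^-1` [set k]) = (nat_pmf Y k)%:E.
Proof.
by rewrite /nat_pmf fineK //; exact: fin_num_measure.
Qed.

(** The event [S = k] is the disjoint union over [n] of the events [F k n], whose probabilities
    factor by independence; countable additivity gives the limit. *)
Lemma random_sum_pmf_cvg k :
  (fun M => \sum_(n < M) mu n * conv_pow p n k) @ \oo --> nat_pmf S k.
Proof.
have mF n : measurable (F k n).
  apply: measurableI; first exact: measurable_funPTI.
  exact: (@measurable_partial_sum _ _ _ P X).
have PF n : P (F k n) = (mu n * conv_pow p n k)%:E.
  rewrite NX; first by rewrite nat_pmfE partial_sum_pmf.
  - by exists [set n] => //; rewrite setTI.
  - exact: sigma_seq_partial_sum.
have FE : S @^-1` [set k] = \bigcup_n F k n.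
  apply/seteqP; split => w /=; first by move=> Sk; exists (N w).
  by move=> [n _ [/= Nn wk]]; rewrite /random_sum Nn.
have tF : trivIset setT (F k) by move=> i j _ _ [w [[/= <- _] [/= <- _]]].
have := measure_semi_sigma_additive (s := P) _ mF tF (bigcupT_measurable _ mF).
rewrite -FE [X in _ --> X](nat_pmfE S k) => /fine_cvg.
apply: cvg_trans; apply: near_eq_cvg.
apply: nearW => M /=; rewrite big_mkord.
by rewrite (eq_bigr _ (fun (i : 'I_M) _ => PF i)) sumEFin.
Qed.

End random_sum_pmf.

(** * Expectations of functions of a variable with values in [nat] *)

Section nat_expectation.
Context d (T : measurableType d) (R : realType) (P : probability T R).
Variable Y : {RV P >-> nat}.

Lemma measurable_nat_comp (c : nat -> R) :
  measurable_fun setT (fun w => c (Y w)).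
Proof.
by apply: (@measurableT_comp _ _ _ _ _ _ c) => //; move=> _ B _.
Qed.

(** Such a function of [Y] is a finite combination of indicators of the events [Y = j], integrated
    term by term. *)
Lemma expectation_finite_support (c : nat -> R) M :
    (forall j, (M <= j)%N -> c j = 0) ->
  ('E_P[fun w => c (Y w)] = (\sum_(0 <= j < M) c j * nat_pmf Y j)%:E)%E.
Proof.
move=> c0; rewrite unlock.
have mY j : measurable (Y @^-1` [set j]) by exact: measurable_funPTI.
have iY j := integrable_indic P (mY j).
transitivity (\int[P]_w (\sum_(0 <= j < M)
    (c j)%:E * (\1_(Y @^-1` [set j]) w)%:E))%E.
  apply: eq_integral => w _.
  under eq_bigr do rewrite -EFinM.
  rewrite sumEFin; congr EFin.
  have [YM|YM] := ltnP (Y w) M; last first.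
    rewrite c0 // big_nat big1 // => j /andP[_ jM].
    rewrite indicE memNset ?mulr0 //= => Yj.
    by move: YM; rewrite Yj leqNgt jM.
  rewrite (bigD1_seq (Y w)) ?mem_index_iota ?iota_uniq //= indicE mem_set //.
  rewrite mulr1 big1 ?addr0 // => j /eqP jY.
  by rewrite indicE memNset ?mulr0 // => /esym.
rewrite integral_sum //; last by move=> j; exact: integrableZl.
rewrite -sumEFin; apply: eq_bigr => j _.
rewrite integralZl // integral_indic // setIT EFinM.
by congr (_ * _)%E; exact: nat_pmfE.
Qed.

Lemma nat_pmf_ge0 k : 0 <= nat_pmf Y k.
Proof. by rewrite -lee_fin -nat_pmfE. Qed.

Lemma nat_pmf_sum_le1 M : \sum_(0 <= j < M) nat_pmf Y j <= 1.
Proof.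
pose c j : R := (j < M)%:R.
rewrite -lee_fin -(expectation_cst P 1).
have <- : ('E_P[fun w => c (Y w)] = (\sum_(0 <= j < M) nat_pmf Y j)%:E)%E.
  rewrite (@expectation_finite_support _ M) => [|j]; last first.
    by rewrite /c ltnNge => ->.
  by congr EFin; apply: eq_big_nat => j /andP[_ jM]; rewrite /c jM mul1r.
apply: expectation_le => //; first exact: measurable_nat_comp.
by apply: aeW => w; rewrite /c /= lern1 leq_b1.
Qed.

(** The left side is the expectation of [Y] replaced by 0 outside [[0, M[]. *)
Lemma nat_pmf_mean_le M :
  ((\sum_(0 <= j < M) j%:R * nat_pmf Y j)%:E <= 'E_P[fun w => (Y w)%:R])%E.
Proof.
pose c j : R := if (j < M)%N then j%:R else 0.
have <- : ('E_P[fun w => c (Y w)] =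
    (\sum_(0 <= j < M) j%:R * nat_pmf Y j)%:E)%E.
  rewrite (@expectation_finite_support _ M) => [|j]; last first.
    by rewrite /c ltnNge => ->.
  by congr EFin; apply: eq_big_nat => j /andP[_ jM]; rewrite /c jM.
apply: expectation_le => //.
- exact: measurable_nat_comp.
- exact: measurable_nat_comp (fun j => j%:R).
- by move=> w; rewrite /c; case: ifP.
- by apply: aeW => w; rewrite /c; case: ifP.
Qed.

Lemma integrable_nat_mean : ('E_P[fun w => (Y w)%:R] < +oo)%E ->
  P.-integrable setT (fun w => ((Y w)%:R : R)%:E).
Proof.
rewrite unlock => Yoo; apply/integrableP; split.
  by apply/measurable_EFinP; exact: measurable_nat_comp (fun j => j%:R).
by under eq_integral do rewrite gee0_abs ?lee_fin //.
Qed.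

End nat_expectation.

(** * Stein identity from the recursion for the mass function *)

Section stein_identity.
Context d (T : measurableType d) (R : realType) (P : probability T R).
Variables (Y : {RV P >-> nat}) (a b : R) (p : nat -> R).
Hypothesis p_ge0 : forall l, 0 <= p l.
Hypothesis p_sum_le1 : forall M, \sum_(0 <= l < M) p l <= 1.
Variables (g : nat -> R) (C D : R).
Hypothesis g_le : forall j, `|g j| <= C.
(** Stands in for a finite mean of [p]. The weight [g] lets it cover the case [K = 0], where [g]
    vanishes but the mean of [X_1] is not controlled by that of [S_N]. *)
Hypothesis g_mean_le : forall j M,
  \sum_(0 <= l < M) `|g (l + j)%N| * (l%:R * p l) <= D.
Let t := panjer_series_term a b p g.

(** The part with [a] is bounded by [g_mean_le], the part with [b] by [C] times the total mass.
    Uniformity in [M] gives absolute convergence; affine growth in [j] gives domination. *)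
Lemma panjer_series_term_abs_le j M :
  \sum_(0 <= l < M) `|t j l| <= `|a| * D + `|b| * j%:R * C.
Proof.
have C0 : 0 <= C by exact: le_trans (g_le 0).
apply: (@le_trans _ _ (`|a| * (\sum_(0 <= l < M) `|g (l + j)%N| * (l%:R * p l))
    + `|b| * j%:R * (C * \sum_(0 <= l < M) p l))).
  rewrite !mulr_sumr -big_split /=; apply: ler_sum => l _.
  rewrite /t /panjer_series_term !normrM (ger0_norm (p_ge0 l)).
  have h1 : `|a * l%:R + b * j%:R| <= `|a| * l%:R + `|b| * j%:R.
    by rewrite (le_trans (ler_normD _ _)) // !normrM !normr_nat.
  have h2 : `|b| * j%:R * (`|g (l + j)%N| * p l) <= `|b| * j%:R * (C * p l).
    by rewrite ler_wpM2l ?mulr_ge0 // ler_wpM2r.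
  apply: (@le_trans _ _ ((`|a| * l%:R + `|b| * j%:R) * (`|g (l + j)%N| * p l))).
    by rewrite -mulrA ler_wpM2r // mulr_ge0.
  rewrite mulrDl; apply: lerD => //.
  by rewrite -mulrA [l%:R * _]mulrCA.
apply: lerD; first by rewrite ler_wpM2l.
by rewrite ler_wpM2l ?mulr_ge0 // ler_piMr.
Qed.

Lemma is_cvg_panjer_series j : cvgn (series (t j)).
Proof.
apply: normed_cvg; apply: nondecreasing_is_cvgn.
  by apply: nondecreasing_series => n _ _ /=.
exists (`|a| * D + `|b| * j%:R * C) => _ [n _ <-].
exact: panjer_series_term_abs_le.
Qed.

(* Contribution of the value [g m] to [panjer_operator a b p g j]; the
   correction [b * p 0 * j * g j] is absorbed as the term [l = 0]. *)
Let c m j := (if (j <= m)%N then (a * (m - j)%:R + b * j%:R) * p (m - j) else 0)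
  - (j == m)%:R * m%:R.
Let h M j := \sum_(0 <= m < M) g m * c m j.

Let h_small M j : (M <= j)%N -> h M j = 0.
Proof.
move=> Mj; rewrite /h big_nat big1 // => m /andP[_ mM].
have mj := leq_trans mM Mj.
by rewrite /c leqNgt mj gtn_eqF // mul0r subr0 mulr0.
Qed.

(** Substitute [m = l + j]; values of [g] below [j] contribute nothing. *)
Let h_large n j : h (n.+1 + j) j = \sum_(0 <= l < n.+1) t j l - j%:R * g j.
Proof.
rewrite /h (@big_cat_nat _ _ _ j) ?leq_addl //= -/(h j j) h_small // add0r.
rewrite -{1}[j]add0n big_addn addnK.
have term l : g (l + j)%N * c (l + j) j = t j l - (l == 0%N)%:R * (j%:R * g j).
  rewrite /c leq_addl addnK mulrBr; congr (_ - _).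
    by rewrite /t /panjer_series_term; ring.
  case: l => [|l]; first by rewrite add0n eqxx !mul1r mulrC.
  by rewrite ltn_eqF ?mul0r ?mulr0 // addSn ltnS leq_addl.
under eq_bigr do rewrite term.
rewrite sumrB; congr (_ - _).
by rewrite big_nat_recl //= mul1r big1 ?addr0 // => l _; rewrite mul0r.
Qed.

Let h_le M j : `|h M j| <= `|a| * D + (`|b| * C + C) * j%:R.
Proof.
have C0 : 0 <= C by exact: le_trans (g_le 0).
have D0 : 0 <= D by have := g_mean_le 0 0; rewrite big_nil.
have [Mj|jM] := leqP M j.
  by rewrite h_small // normr0 addr_ge0 // mulr_ge0 // addr_ge0 // mulr_ge0.
have -> : M = ((M - j).-1.+1 + j)%N.
  by rewrite prednK ?subn_gt0 // subnK // ltnW.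
rewrite h_large (le_trans (ler_normB _ _)) // mulrDl addrA.
apply: lerD.
  rewrite (le_trans (ler_norm_sum _ _ _)) //.
  by rewrite (le_trans (panjer_series_term_abs_le _ _)) // mulrAC.
by rewrite normrM normr_nat mulrC ler_wpM2r.
Qed.

Let h_cvg j : h ^~ j @ \oo --> panjer_operator a b p g j.
Proof.
have ct := @is_cvg_panjer_series j.
have ct1 : cvgn [sequence \sum_(1 <= l < n) t j l]_n.
  by rewrite is_cvg_series_restrict.
(* The two shifts bring the index to the form of [h_large]. Its term [l = 0] is [b * p 0 * j * g j],
   which supplies the correction in the operator. *)
rewrite -(cvg_shiftn j) -cvg_shiftS.
have -> : [sequence [sequence h (n + j) j]_n n.+1]_n =
  (fun n => [sequence \sum_(1 <= l < n) t j l]_n n.+1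
    - (1 - b * p 0%N) * j%:R * g j).
  apply/funext => n /=; rewrite h_large [X in X - _ = _]big_ltn //.
  by rewrite /t /panjer_series_term add0n; ring.
apply: cvgB; last exact: cvg_cst.
by rewrite (cvg_shiftS [sequence \sum_(1 <= l < n) t j l]_n).
Qed.

Hypothesis Y_recursion : forall m,
  \sum_(l < m.+1) (a * l%:R + b * (m - l)%:R) * p l * nat_pmf Y (m - l) =
  m%:R * nat_pmf Y m.
Hypothesis Y_mean : ('E_P[fun w => (Y w)%:R] < +oo)%E.

(** After exchanging sums, the coefficient of each [g m] is the difference of the two sides of
    [Y_recursion] at [m], read with [l = m - j]. *)
Let expectation_h M : ('E_P[fun w => h M (Y w)] = 0)%E.
Proof.
rewrite (@expectation_finite_support _ _ _ _ _ (h M) M); last exact: h_small.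
congr EFin; under eq_bigr do rewrite mulr_suml.
rewrite exchange_big /= big_nat big1 // => m /andP[_ mM].
under eq_bigr do rewrite -mulrA.
rewrite -mulr_sumr (@big_cat_nat _ _ _ m.+1) //=.
rewrite [X in _ + X]big_nat [X in _ + X]big1 => [|j /andP[mj _]]; last first.
  by rewrite /c leqNgt mj gtn_eqF // mul0r subr0 mul0r.
rewrite addr0 (_ : \sum_(_ <= _ < _) _ = 0) ?mulr0 //.
rewrite big_mkord; under eq_bigr do rewrite /c mulrBl -ltnS ltn_ord.
rewrite sumrB [X in _ - X]big_ord_recr /= eqxx mul1r.
rewrite [X in _ - (X + _)]big1; last first.
  by move=> j _; rewrite ltn_eqF // !mul0r.
rewrite add0r; apply/eqP; rewrite subr_eq0; apply/eqP.
rewrite -Y_recursion (reindex_inj rev_ord_inj) /=.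
by apply: eq_bigr => j _; rewrite subSS subKn // -ltnS.
Qed.

Lemma expectation_panjer_operator :
  ('E_P[fun w => panjer_operator a b p g (Y w)] = 0)%E.
Proof.
have := expectation_h; rewrite unlock => Eh.
(* The bound of [h_le], free of [M] and integrable because [Y] has finite mean. *)
pose G w : R := `|a| * D + (`|b| * C + C) * (Y w)%:R.
have iG : P.-integrable setT (fun w => (G w)%:E).
  under eq_fun do rewrite /G EFinD [((_ + _) * _)%:E]EFinM.
  apply: integrableD => //.
    exact: finite_measure_integrable_cst.
  by apply: integrableZl => //; exact: integrable_nat_mean.
have cvgE : (fun n => \int[P]_w (h n (Y w))%:E)%E @ \oo -->
    (\int[P]_w (panjer_operator a b p g (Y w))%:E)%E.
  apply: (@dominated_cvg _ _ _ P setT measurableT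
    (fun n w => (h n (Y w))%:E) _ (EFin \o G)) => //.
  - by move=> n; apply/measurable_EFinP; exact: (measurable_nat_comp Y (h n)).
  - move=> w _; apply: cvg_EFin; first exact: nearW.
    exact: h_cvg.
  - by move=> n w _; rewrite lee_fin; exact: h_le.
rewrite (_ : (fun n => _) = fun=> 0%E) in cvgE; last exact/funext.
exact: (cvg_unique (@ereal_hausdorff R) cvgE (cvg_cst _)).
Qed.

End stein_identity.

(** Convergence of both series makes the limit additive, as [limn] is only a default value on
    divergent sequences. *)
Lemma panjer_operator_linear (R : realType) (a b c : R) (p g h : nat -> R) j :
    cvgn (fun n => \sum_(1 <= l < n) panjer_series_term a b p g j l) ->
    cvgn (fun n => \sum_(1 <= l < n) panjer_series_term a b p h j l) ->
  panjer_operator a b p (fun k => c * g k + h k) j =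
  c * panjer_operator a b p g j + panjer_operator a b p h j.
Proof.
move=> cvg_g cvg_h; rewrite /panjer_operator.
have -> : limn (fun n => \sum_(1 <= l < n)
      panjer_series_term a b p (fun k => c * g k + h k) j l) =
    c * limn (fun n => \sum_(1 <= l < n) panjer_series_term a b p g j l) +
    limn (fun n => \sum_(1 <= l < n) panjer_series_term a b p h j l).
  apply: cvg_lim => //.
  under eq_fun => n.
    rewrite (_ : \sum_(_ <= _ < _) _ =
      c * \sum_(1 <= l < n) panjer_series_term a b p g j l +
      \sum_(1 <= l < n) panjer_series_term a b p h j l); last first.
      rewrite mulr_sumr -big_split; apply: eq_bigr => l _ /=.
      by rewrite /panjer_series_term; ring.
  over.
  by apply: cvgD => //; apply: cvgMl_tmp.
ring.
Qed.

(** * Compound Panjer laws: recursion and mean bound *)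

Section compound_panjer.
Context d (T : measurableType d) (R : realType) (P : probability T R).
Variables (K : option nat) (a b : R) (N : {RV P >-> nat}).
Variable X : nat -> {RV P >-> nat}.
Hypothesis N_below : distribution P N [set k | below K k] = 1%E.
Hypothesis N_gt0 : forall k, below K k -> 0 < nat_pmf N k.
Hypothesis N_panjer : forall k, below K k ->
  k.+1%:R * nat_pmf N k.+1 / nat_pmf N k = a + b * k%:R.
Hypothesis X_iid : iid X.
Hypothesis NX : independent P (g_sigma_algebra_preimage N) (sigma_seq X).
Let mu := nat_pmf N.
Let p := nat_pmf (X 0%N).
Let S : {RV P >-> nat} := random_sum N X.

Let mu_out n : ~~ below K n -> mu n = 0.
Proof.
move=> nK; apply/eqP; rewrite eq_le nat_pmf_ge0 andbT -lee_fin -nat_pmfE.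
have mB : measurable (N @^-1` [set k | below K k]).
  exact: measurable_funPTI.
have -> : (0%:E = P (~` (N @^-1` [set k | below K k])))%E.
  by rewrite probability_setC // [X in (_ - X)%E]N_below subee.
apply: le_measure; rewrite ?inE; [exact: measurable_funPTI|exact: measurableC|].
by move=> w /= ->; exact/negP.
Qed.

(** Clearing the denominator extends the recursion to all [n]: above [K] both sides are 0. *)
Let mu_panjer n : n.+1%:R * mu n.+1 = (a + b * n%:R) * mu n.
Proof.
have [nK|nK] := boolP (below K n).
  by rewrite -N_panjer // divfK // gt_eqF // N_gt0.
rewrite !mu_out ?mulr0 //; apply: contra nK.
by rewrite /below; case: K => // m /ltnW.
Qed.

Lemma random_sum_panjer_recursion m :
  \sum_(l < m.+1) (a * l%:R + b * (m - l)%:R) * p l * nat_pmf S (m - l) =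
  m%:R * nat_pmf S m.
Proof.
apply: (panjer_recursion mu_panjer); exact: random_sum_pmf_cvg.
Qed.

Let conv_pow1 k : conv_pow p 1 k = p k.
Proof.
rewrite /= big_ord_recr /= subnn mulr1 big1 ?add0r // => i _.
by rewrite subn_eq0 leqNgt ltn_ord mulr0.
Qed.

Let conv_pow_ge0 n k : 0 <= conv_pow p n k.
Proof.
elim: n k => [|n IH] k //=; apply: sumr_ge0 => i _.
by rewrite mulr_ge0 // nat_pmf_ge0.
Qed.

(** Keep only the term [n = 1] of the mixture. Weighting by [l] and summing bounds the mean of [X_1]
    by that of [S_N] over [mu 1]. *)
Lemma random_sum_pmf_ge l : mu 1 * p l <= nat_pmf S l.
Proof.
have cv := random_sum_pmf_cvg X_iid NX (k := l).
rewrite -(cvg_lim _ cv) //; apply: limr_ge.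
  by apply/cvg_ex; eexists; exact: cv.
exists 2 => // -[//|[//|M]] _.
rewrite [leRHS](big_ord_recl M.+1) big_ord_recl conv_pow1 addrCA.
rewrite lerDl addr_ge0 //.
  by rewrite mulr_ge0 // nat_pmf_ge0.
apply: sumr_ge0 => i _.
by rewrite mulr_ge0 ?nat_pmf_ge0 //; exact: conv_pow_ge0.
Qed.

Lemma random_sum_pmf_degenerate l : ~~ below K 1 -> (0 < l)%N ->
  nat_pmf S l = 0.
Proof.
move=> K1 l0; have cv := random_sum_pmf_cvg X_iid NX (k := l).
rewrite -(cvg_lim _ cv) //; under eq_fun => M.
  rewrite big1 => [|[[|n] nM] _]; first over.
    by rewrite /= gtn_eqF // mulr0.
  rewrite -/mu mu_out ?mul0r //=; apply: contra K1.
  by rewrite /below; case: K => // m /=; apply: leq_ltn_trans.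
by rewrite lim_cst.
Qed.

Hypothesis S_mean : ('E_P[fun w => (random_sum N X w)%:R] < +oo)%E.

Lemma stein_class_mean_le g C : stein_class S g -> (forall j, `|g j| <= C) ->
  exists D, forall j M,
    \sum_(0 <= l < M) `|g (l + j)%N| * (l%:R * p l) <= D.
Proof.
move=> [_ g0 gsupp] gC.
(* If [K = 0], the support of [S] lies in [{0}], so [g] is identically 0 and [D = 0] works. *)
have [K1|K1] := boolP (below K 1); last first.
  exists 0 => j M; rewrite big1 // => l _.
  have [->|lj] := posnP (l + j)%N; first by rewrite g0 normr0 mul0r.
  rewrite gsupp ?normr0 ?mul0r // /supp /= random_sum_pmf_degenerate //.
  by rewrite ltxx.
have mu1 : 0 < mu 1 by exact: N_gt0.
have E0 : (0 <= 'E_P[fun w => (random_sum N X w)%:R])%E.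
  by apply: expectation_ge0.
pose e := fine ('E_P[fun w => (random_sum N X w)%:R]).
have eE : ('E_P[fun w => (random_sum N X w)%:R] = e%:E)%E.
  by rewrite fineK // ge0_fin_numE.
exists (C * (e / mu 1)) => j M.
have C0 : 0 <= C by exact: le_trans (gC 0).
apply: (@le_trans _ _ (C * \sum_(0 <= l < M) l%:R * p l)).
  rewrite mulr_sumr; apply: ler_sum => l _.
  by rewrite ler_wpM2r // mulr_ge0 // nat_pmf_ge0.
rewrite ler_wpM2l // ler_pdivlMr // mulr_suml -lee_fin -eE.
apply: le_trans (nat_pmf_mean_le S M); rewrite lee_fin; apply: ler_sum => l _.
by rewrite -mulrA ler_wpM2l // mulrC random_sum_pmf_ge.
Qed.

End compound_panjer.

Theorem theorem2p6 (d : measure_display) (T : measurableType d) (R : realType)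
    (P : probability T R) (K : option nat) (a b : R)
    (N : {RV P >-> nat}) (X : nat -> {RV P >-> nat})
    (hN : distribution P N [set k | below K k] = 1%E)
    (hpos : forall k, below K k -> 0 < nat_pmf N k)
    (hpanjer : forall k, below K k ->
       k.+1%:R * nat_pmf N k.+1 / nat_pmf N k = a + b * k%:R)
    (hiid : iid X)
    (hindep : independent P (g_sigma_algebra_preimage N) (sigma_seq X))
    (hmean : ('E_P[fun w => (random_sum N X w)%:R] < +oo)%E) :
  (forall g, stein_class (random_sum N X : {RV P >-> nat}) g -> forall j,
     cvgn (fun n => \sum_(1 <= l < n)
                      panjer_series_term a b (nat_pmf (X 0%N)) g j l)) /\
  stein_operator (random_sum N X : {RV P >-> nat})
    (panjer_operator a b (nat_pmf (X 0%N))).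
Proof.
have bounds g : stein_class (random_sum N X : {RV P >-> nat}) g ->
    exists C D, (forall j, `|g j| <= C) /\ (forall j M, \sum_(0 <= l < M)
      `|g (l + j)%N| * (l%:R * nat_pmf (X 0%N) l) <= D).
  move=> gS; have [[M [_ gM]] _ _] := gS.
  (* [bounded_fun] provides a bound by every number strictly above [M], hence the [+ 1]. *)
  have gC j : `|g j| <= M + 1 by apply: gM => //; rewrite ltrDl.
  have [D gD] := stein_class_mean_le hN hpos hiid hindep hmean gS gC.
  by exists (M + 1), D.
have p0 := nat_pmf_ge0 (X 0%N); have p1 := nat_pmf_sum_le1 (X 0%N).
have cvg_term g : stein_class (random_sum N X : {RV P >-> nat}) g -> forall j,
    cvgn (fun n => \sum_(1 <= l < n)
                     panjer_series_term a b (nat_pmf (X 0%N)) g j l).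
  move=> /bounds[C [D [gC gD]]] j.
  have := is_cvg_panjer_series (a := a) (b := b) p0 p1 gC gD (j := j).
  by rewrite -(is_cvg_series_restrict 1).
split=> //; split=> [c g h gS hS j|g /bounds[C [D [gC gD]]]].
  by apply: panjer_operator_linear; exact: cvg_term.
apply: (expectation_panjer_operator p0 p1 gC gD) => //.
exact: (random_sum_panjer_recursion hN hpos hpanjer hiid hindep).
Qed.
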